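(* Let $(\Omega,\mu)$ be a measure space with positive measure $\mu$, $H$ a separable Hilbert space, $\{H_\omega\}_{\omega\in\Omega}$ a family of Hilbert spaces, and $K\in B(H)$. Let $\{\Lambda_\omega\}_{\omega\in\Omega}$ be a c-g-Bessel family for $H$ with respect to $\{H_\omega\}_{\omega\in\Omega}$. Then $\{\Lambda_\omega\}_{\omega\in\Omega}$ is a c-K-g-frame for $H$ with respect to $\{H_\omega\}_{\omega\in\Omega}$ if and only if there exists a constant $A>0$ such that $S\ge AKK^*$, where $S$ is the frame operator of $\{\Lambda_\omega\}_{\omega\in\Omega}$.
   Context: $B(H,H')$ denotes the bounded linear operators from $H$ to $H'$, and $B(H)=B(H,H)$. Let $\prod_{\omega\in\Omega}H_\omega=\{f:\Omega\to\cup_{\omega\in\Omega}H_\omega:\ f(\omega)\in H_\omega\}$. An element $F\in\prod_{\omega\in\Omega}H_\omega$ is strongly measurable if $F$, as a mapping of $\Omega$ to $\oplus_{\omega\in\Omega}H_\omega$ (each $H_\omega$ viewed as the $\omega$-th summand), is measurable. For $K\in B(H)$, a family $\{\Lambda_\omega\in B(H,H_\omega):\omega\in\Omega\}$ is a c-K-g-frame (continuous K-g-frame) for $H$ with respect to $\{H_\omega\}_{\omega\in\Omega}$ if (i) for each $f\in H$, $\{\Lambda_\omega f\}_{\omega\in\Omega}$ is strongly measurable; (ii) there exist constants $0<A\le B<\infty$ such that $A\|K^*f\|^2\le\int_\Omega\|\Lambda_\omega f\|^2d\mu(\omega)\le B\|f\|^2$ for all $f\in H$. The family is called a c-g-Bessel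 family for $H$ with respect to $\{H_\omega\}_{\omega\in\Omega}$ if (i) holds and the right-hand inequality in (ii) holds for some $B<\infty$. The frame operator $S:H\to H$ of such a family is defined weakly by $\langle Sf,g\rangle=\int_\Omega\langle f,\Lambda_\omega^*\Lambda_\omega g\rangle\,d\mu(\omega)$ for $f,g\in H$. For self-adjoint operators, $S\ge T$ means $\langle Sf,f\rangle\ge\langle Tf,f\rangle$ for all $f\in H$. *)

(* Defs.v *)
From HB Require Import structures.
From mathcomp Require Import all_boot all_order all_algebra.
From mathcomp Require Import sesquilinear complex.
From mathcomp Require Import all_classical all_reals all_analysis.

Set Implicit Arguments.
Unset Strict Implicit.
Unset Printing Implicit Defensive.
Import Order.TTheory GRing.Theory Num.Theory.
Import numFieldNormedType.Exports.

Local Open Scope classical_set_scope.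
Local Open Scope ring_scope.
Local Open Scope complex_scope.

(* Complex Hilbert spaces: complete normed spaces over R[i] whose norm comes
   from an inner product, linear in its first argument. *)
HB.mixin Record CompleteNormedModule_isHilbert (R : realType) H
    & CompleteNormedModule R[i] H := {
  inner : {dot H for (@Num.conj R[i])} ;
  inner_norm : forall x : H, `|x| ^+ 2 = inner x x
}.

#[short(type="hilbertType")]
HB.structure Definition Hilbert (R : realType) :=
  {H of CompleteNormedModule R[i] H & CompleteNormedModule_isHilbert R H}.

(* The norm of the library takes its values in the scalars R[i]; they are
   nonnegative reals, and rnorm x is the same number, as an element of R. *)
Definition rnorm (R : realType) (V : normedModType R[i]) (x : V) : R :=
  complex.Re `|x|.

Definition separable (T : topologicalType) :=
  exists2 D : set T, countable D & dense D.

Record bounded_operator (R : realType) (H H' : hilbertType R) :=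
  BoundedOperator {
    bounded_operator_fun :> {linear H -> H'} ;
    bounded_operatorP : exists M : R,
      forall x, rnorm (bounded_operator_fun x) <= M * rnorm x
  }.

Notation "''B' ( H , H' )" := (bounded_operator H H')
  (at level 8, format "''B' ( H ,  H' )") : type_scope.

(* The unique T' with <T x, y> = <x, T' y>; it exists by Riesz
   representation, so the default value of xget plays no role. *)
Definition adjoint (R : realType) (H H' : hilbertType R) (T : 'B(H, H')) :
    H' -> H :=
  xget (fun=> 0)
    [set T' : H' -> H | forall x y, inner (T x) y = inner x (T' y)].

(* For operators S and T that are self-adjoint, both sides are real numbers,
   and the order of R[i] is then that of R. *)
Definition operator_ge (R : realType) (H : hilbertType R) (S T : H -> H) :=
  forall f, inner (T f) f <= inner (S f) f.

Section direct_sum.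
Context (R : realType) (Omega : pointedType) (H_ : Omega -> hilbertType R).

Definition sum_sqnorm (x : forall w, H_ w) : \bar R :=
  \esum_(w in setT) (rnorm (x w) ^+ 2)%:E.

(* The Hilbert space direct sum of the H_ w, i.e. the square-summable
   elements of the product. *)
Record direct_sum := DirectSum {
  direct_sum_fun :> forall w, H_ w ;
  direct_sumP : (sum_sqnorm direct_sum_fun < +oo)%E
}.

(* Openness for the norm x |-> sum_sqnorm x ^ (1/2). *)
Definition direct_sum_open (U : set direct_sum) :=
  forall x, U x -> exists2 e : R, 0 < e &
    forall y : direct_sum,
      (sum_sqnorm (fun w => x w - y w)%R < (e ^+ 2)%:E)%E -> U y.

Lemma summand_subproof (w : Omega) (v : H_ w) :
  (sum_sqnorm (dfwith (fun=> 0%R) w v) < +oo)%E.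
Proof.
rewrite /sum_sqnorm (_ : esum _ _ =
    \esum_(i in [set w]) (rnorm (dfwith (fun=> 0%R) w v i) ^+ 2)%:E).
  by rewrite esum_set1 ?ltry// lee_fin sqr_ge0.
rewrite [RHS]esum_mkcond; apply: eq_esum => i _; case: ifPn => //.
rewrite notin_setE/= => wi; rewrite dfwithout; last by apply/eqP => /esym.
by rewrite /rnorm normr0 expr0n.
Qed.

(* The element of the direct sum with v in the summand of index w. *)
Definition summand (w : Omega) (v : H_ w) : direct_sum :=
  DirectSum (summand_subproof v).

HB.instance Definition _ := gen_eqMixin direct_sum.
HB.instance Definition _ := gen_choiceMixin direct_sum.
HB.instance Definition _ := isPointed.Build direct_sum (summand (0 : H_ point)).

(* direct_sum with its Borel sigma-algebra *)
Definition direct_sum_borel := g_sigma_algebraType direct_sum_open.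

End direct_sum.

Definition strongly_measurable (R : realType) (d : measure_display)
    (Omega : measurableType d) (H_ : Omega -> hilbertType R)
    (F : forall w, H_ w) :=
  measurable_fun setT (fun w => summand (F w) : direct_sum_borel H_).

Definition complex_integral (R : realType) (d : measure_display)
    (Omega : measurableType d) (mu : {measure set Omega -> \bar R})
    (F : Omega -> R[i]) : R[i] :=
  (\int[mu]_w complex.Re (F w)) +i* (\int[mu]_w complex.Im (F w)).

Section frames.
Context (R : realType) (d : measure_display) (Omega : measurableType d).
Context (mu : {measure set Omega -> \bar R}).
Context (H : hilbertType R) (H_ : Omega -> hilbertType R).

Definition c_g_bessel (Lambda : forall w, 'B(H, H_ w)) :=
  (forall f, strongly_measurable (fun w => Lambda w f)) /\
  exists B : R, forall f,
    (\int[mu]_w (rnorm (Lambda w f) ^+ 2)%:E <= (B * rnorm f ^+ 2)%:E)%E.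

Definition c_K_g_frame (K : 'B(H, H)) (Lambda : forall w, 'B(H, H_ w)) :=
  (forall f, strongly_measurable (fun w => Lambda w f)) /\
  exists A B : R, [/\ 0 < A, A <= B & forall f,
    ((A * rnorm (adjoint K f) ^+ 2)%:E
       <= \int[mu]_w (rnorm (Lambda w f) ^+ 2)%:E)%E /\
    (\int[mu]_w (rnorm (Lambda w f) ^+ 2)%:E <= (B * rnorm f ^+ 2)%:E)%E].

(* The unique S satisfying the weak definition; for a c-g-Bessel family the
   integrands are integrable and S exists by Riesz representation, so the
   default value of xget plays no role. *)
Definition frame_operator (Lambda : forall w, 'B(H, H_ w)) : H -> H :=
  xget (fun=> 0) [set S : H -> H | forall f g, inner (S f) g =
    complex_integral mu
      (fun w => inner f (adjoint (Lambda w) (Lambda w g)))].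

End frames.

(* Main.v *)
Require Import Defs.
From HB Require Import structures.
From mathcomp Require Import all_boot all_order all_algebra.
From mathcomp Require Import sesquilinear complex ring lra.
From mathcomp Require Import all_classical all_reals all_analysis.
From mathcomp Require Import measurable_realfun.

Set Implicit Arguments.
Unset Strict Implicit.
Unset Printing Implicit Defensive.
Import Order.TTheory GRing.Theory Num.Theory.
Import numFieldNormedType.Exports.

Local Open Scope classical_set_scope.
Local Open Scope ring_scope.
Local Open Scope complex_scope.

(** The lower frame bound and the operator inequality are the same family of
    inequalities.  By the weak definition of the frame operator S,
    <S f, f> = \int <f, Lambda_w^* Lambda_w f> = \int |Lambda_w f|^2, and
    <A K K^* f, f> = A |K^* f|^2; so S >= A K K^* says exactly that
    A |K^* f|^2 <= \int |Lambda_w f|^2 for all f ([operator_geP]).  The upper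
    bound of a frame is the Bessel bound, enlarged to be at least A.

    What needs work is that the adjoints and S, which are chosen among the
    maps satisfying their defining identities, do satisfy them.  Both rest on
    the Riesz representation theorem ([riesz]), proved here by minimizing
    |x|^2 - 2 l x: near-minimizers represent l up to an error proportional to
    |z|, so they form a Cauchy sequence, and its limit represents l exactly.
    Everything is done for the real part of the inner product and for
    real-linear functionals; the imaginary part comes back for free from
    Im <x, y> = Re <x, i y> ([riesz_inner]).

    For S ([frame_operatorP]) the functional is g |-> \int Re <Lambda_w f,
    Lambda_w g>.  Strong measurability makes w |-> |Lambda_w f| measurable,
    because having a coordinate of norm greater than r is an open condition
    on the direct sum ([direct_sum_open_coord]); polarization then yields the
    integrability of the integrand from the Bessel bound. *)

(** * Inner products and their real parts *)

Definition re_inner (R : realType) (H : hilbertType R) (x y : H) : R :=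
  complex.Re (inner x y).

Section real_inner_product.
Context {R : realType} {H : hilbertType R}.
Implicit Types (x y z : H) (t : R).

Lemma normE (V : normedModType R[i]) (v : V) : `|v| = (rnorm v)%:C.
Proof. by rewrite /rnorm RRe_real// ger0_real. Qed.

Lemma rnorm_ge0 (V : normedModType R[i]) (v : V) : 0 <= rnorm v.
Proof. by rewrite -lecR -normE normr_ge0. Qed.

Lemma rnorm_triangle (V : normedModType R[i]) (v w : V) :
  rnorm (v + w) <= rnorm v + rnorm w.
Proof. by rewrite -lecR rmorphD/= -!normE ler_normD. Qed.

Lemma inner_self x : inner x x = (rnorm x ^+ 2)%:C.
Proof. by rewrite -inner_norm normE rmorphXn. Qed.

Lemma innerC x y : inner x y = (inner y x)^*.
Proof. by rewrite hermC/= expr0 mul1r. Qed.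

Lemma re_innerC x y : re_inner x y = re_inner y x.
Proof. by rewrite /re_inner innerC; case: (inner y x). Qed.

Lemma re_inner_self x : re_inner x x = rnorm x ^+ 2.
Proof. by rewrite /re_inner inner_self. Qed.

Lemma re_innerDr x y z : re_inner x (y + z) = re_inner x y + re_inner x z.
Proof. by rewrite /re_inner linearDr raddfD. Qed.

Lemma re_innerDl x y z : re_inner (x + y) z = re_inner x z + re_inner y z.
Proof. by rewrite !(re_innerC _ z) re_innerDr. Qed.

Lemma re_innerZr t x y : re_inner x (t%:C *: y) = t * re_inner x y.
Proof.
rewrite /re_inner linearZr_LR/= -[Num.conj _]/((t%:C)^*) conjc_real.
by case: (inner x y) => a b /=; ring.
Qed.

Lemma re_innerZl t x y : re_inner (t%:C *: x) y = t * re_inner x y.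
Proof. by rewrite re_innerC re_innerZr re_innerC. Qed.

Lemma re_innerNl x y : re_inner (- x) y = - re_inner x y.
Proof. by rewrite /re_inner linearNl raddfN. Qed.

Lemma re_innerBl x y z : re_inner (x - y) z = re_inner x z - re_inner y z.
Proof. by rewrite re_innerDl re_innerNl. Qed.

(** This is why real parts suffice: the inner product is conjugate-linear in
    its second argument, so multiplying there by i moves the imaginary part to
    the real part. *)
Lemma im_inner x y : complex.Im (inner x y) = re_inner x ('i *: y).
Proof.
rewrite /re_inner linearZr_LR/= -[Num.conj _]/(('i : R[i])^*).
by case: (inner x y) => a b /=; ring.
Qed.

Lemma innerE x y : inner x y = re_inner x y +i* re_inner x ('i *: y).
Proof. by rewrite -im_inner /re_inner; case: (inner x y). Qed.

Lemma sqr_rnormD x y :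
  rnorm (x + y) ^+ 2 = rnorm x ^+ 2 + 2 * re_inner x y + rnorm y ^+ 2.
Proof.
by rewrite -!re_inner_self re_innerDl !re_innerDr (re_innerC y x); ring.
Qed.

Lemma sqr_rnormZ t x : rnorm (t%:C *: x) ^+ 2 = t ^+ 2 * rnorm x ^+ 2.
Proof. by rewrite -!re_inner_self re_innerZl re_innerZr; ring. Qed.

Lemma re_inner_polarization x y :
  re_inner x y = 2^-1 * (rnorm (x + y) ^+ 2 - rnorm x ^+ 2 - rnorm y ^+ 2).
Proof. by rewrite sqr_rnormD; field. Qed.

End real_inner_product.

(** Evaluating at the minimum t = - c / n gives the bound.  The case n = 0 is
    included, so that a vector of norm 0 needs no separate treatment. *)
Lemma sqr_le_of_quadratic_ge0 (R : realType) (a c n : R) : 0 <= n ->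
  (forall t, 0 <= a + 2 * t * c + t ^+ 2 * n) -> c ^+ 2 <= a * n.
Proof.
rewrite le_eqVlt => /predU1P[<- P|n0 /(_ (- c / n))].
  have [->|c0] := eqVneq c 0; first by rewrite expr0n mulr0.
  (* the polynomial a + 2tc takes the value -1 here *)
  have := P (- (a + 1) / (2 * c)).
  suff -> : a + 2 * (- (a + 1) / (2 * c)) * c + (- (a + 1) / (2 * c)) ^+ 2 * 0
     = -1 by lra.
  by field.
have -> : a + 2 * (- c / n) * c + (- c / n) ^+ 2 * n = (a * n - c ^+ 2) / n.
  by field; exact: lt0r_neq0.
by rewrite pmulr_lge0 ?invr_gt0// subr_ge0.
Qed.

Lemma ler_abs_of_quadratic_ge0 (R : realType) (a c n : R) : 0 <= a -> 0 <= n ->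
  (forall t, 0 <= a ^+ 2 + 2 * t * c + t ^+ 2 * n ^+ 2) -> `|c| <= a * n.
Proof.
move=> a0 n0 /sqr_le_of_quadratic_ge0 => /(_ (sqr_ge0 n)).
by rewrite -exprMn -real_normK ?num_real// ler_sqr ?nnegrE ?mulr_ge0.
Qed.

Lemma cauchy_schwarz (R : realType) (H : hilbertType R) (x y : H) :
  `|re_inner x y| <= rnorm x * rnorm y.
Proof.
apply: ler_abs_of_quadratic_ge0; rewrite ?rnorm_ge0// => t.
by rewrite -mulrA -re_innerZr -sqr_rnormZ -sqr_rnormD sqr_ge0.
Qed.

(** * Riesz representation *)

Section riesz.
Context (R : realType) (H : hilbertType R) (l : H -> R).
Hypothesis lD : forall x y, l (x + y) = l x + l y.
Hypothesis lZ : forall (t : R) x, l (t%:C *: x) = t * l x.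
Variable C : R.
(** Boundedness of l in a quadratic form: if |l x| <= M |x|, it holds with
    C = M^2.  It says that |x|^2 - 2 l x is bounded below, and for an integral
    of inner products it follows from a pointwise estimate, without the
    Cauchy-Schwarz inequality for integrals. *)
Hypothesis l_bounded : forall x, 2 * l x <= C + rnorm x ^+ 2.

(** A near-minimizer x of J x = |x|^2 - 2 l x: moving by t z changes J by
    2 t (Re <x, z> - l z) + t^2 |z|^2, which is at least - e^2 for all t, and
    the discriminant bounds the linear coefficient. *)
Lemma approximate_representer (e : R) : 0 < e ->
  exists x, forall z, `|re_inner x z - l z| <= e * rnorm z.
Proof.
move=> e0; pose J x := rnorm x ^+ 2 - 2 * l x.
have infJ : has_inf (range J).
  split; first by exists (J 0), 0.
  by exists (- C) => _ [x _ <-]; rewrite /J; have := l_bounded x; lra.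
have [_ [x _ <-] Jx] := inf_adherent (exprn_gt0 2 e0) infJ.
exists x => z; apply: ler_abs_of_quadratic_ge0; rewrite ?rnorm_ge0 ?ltW// => t.
have : inf (range J) <= J (x + t%:C *: z).
  by apply: ge_inf; [exact: infJ.2|exists (x + t%:C *: z)].
rewrite {2}/J sqr_rnormD sqr_rnormZ re_innerZr lD lZ.
by move: Jx; rewrite /J; lra.
Qed.

(** If u_m and u_n represent l up to errors e_m |z| and e_n |z|, then taking
    z = u_m - u_n gives |u_m - u_n| <= e_m + e_n; so the approximate
    representers form a Cauchy sequence, and their limit represents l. *)
Lemma riesz : exists x, forall z, re_inner x z = l z.
Proof.
have /choice[u uP] : forall n : nat, exists x, forall z,
    `|re_inner x z - l z| <= n.+1%:R^-1 * rnorm z.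
  by move=> n; exact: approximate_representer.
have u_dist m n : rnorm (u m - u n) <= m.+1%:R^-1 + n.+1%:R^-1.
  set z := u m - u n.
  have : rnorm z ^+ 2 <= (m.+1%:R^-1 + n.+1%:R^-1) * rnorm z.
    rewrite -re_inner_self {1}/z re_innerBl.
    move: (uP m z) (uP n z); rewrite !ler_norml => /andP[_ +] /andP[+ _].
    by move: (m.+1%:R^-1) (n.+1%:R^-1) => a b; lra.
  have [->|z0] := eqVneq (rnorm z) 0; first by rewrite addr_ge0.
  by rewrite expr2 ler_pM2r// lt0r z0 rnorm_ge0.
have u_cvg : cvg (u @ \oo).
  apply: cauchy_cvg; apply: cauchy_exP => e e0.
  have e_re : e = (complex.Re e)%:C by rewrite RRe_real// gtr0_real.
  have Re0 : 0 < complex.Re e / 2 by rewrite divr_gt0// -ltcR -e_re.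
  have [N _ NP] := near_infty_natSinv_lt (PosNum Re0).
  exists (u N), N => // n /= Nn.
  rewrite -ball_normE /ball_ /= normE e_re ltcR (le_lt_trans (u_dist _ _))//.
  move: (NP _ (leqnn N)) (NP _ Nn) => /=.
  by move: (N.+1%:R^-1) (n.+1%:R^-1) => a b; lra.
have [x ux] := (cvg_ex (u @ \oo)).1 u_cvg.
exists x => z; apply/eqP; rewrite -subr_eq0 -normr_le0.
apply/ler_addgt0Pl => e e0; rewrite addr0.
have d0 : 0 < e / (2 * (rnorm z + 1)).
  by rewrite divr_gt0// mulr_gt0// ltr_wpDl ?rnorm_ge0.
have [n []] : exists n, n.+1%:R^-1 < e / (2 * (rnorm z + 1)) /\
    rnorm (x - u n) < e / (2 * (rnorm z + 1)).
  have dC0 : 0 < (e / (2 * (rnorm z + 1)))%:C by rewrite ltcR.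
  near \oo => n; exists n; split.
    by near: n; exact: (near_infty_natSinv_lt (PosNum d0)).
  rewrite -ltcR -normE; near: n.
  by move/cvgrPdist_lt : ux => /(_ _ dC0).
set d := e / _ => nd xd; have dE : d * (rnorm z + 1) = e / 2.
  rewrite /d; field; rewrite gt_eqF//.
  by rewrite ltr_wpDl ?rnorm_ge0.
have z0 := rnorm_ge0 z.
have := le_trans (cauchy_schwarz (x - u n) z) (ler_wpM2r z0 (ltW xd)).
have := le_trans (uP n z) (ler_wpM2r z0 (ltW nd)).
rewrite re_innerBl !ler_norml => /andP[? ?] /andP[? ?].
have d_gt0 : 0 < d := d0.
by apply/andP; split; lra.
Unshelve. all: by end_near. Qed.

End riesz.

(** A representation for real parts of inner products with T x is one for
    the inner products themselves: T being complex linear, the real identity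
    at i x is the imaginary identity at x. *)
Lemma riesz_inner (R : realType) (H H' : hilbertType R)
    (T : {linear H -> H'}) (y : H') (y' : H) :
  (forall x, re_inner y' x = re_inner y (T x)) ->
  forall x, inner (T x) y = inner x y'.
Proof.
move=> yP x; rewrite (innerC (T x)) (innerC x); congr (_^*).
by rewrite !innerE -linearZ !yP.
Qed.

(** The functional x |-> Re <y, T x> is bounded by M |y| |x|, so its
    representer can serve as the value of the adjoint at y. *)
Lemma adjointP (R : realType) (H H' : hilbertType R) (T : 'B(H, H')) x y :
  inner (T x) y = inner x (adjoint T y).
Proof.
suff /choice[T' T'P] : forall y, exists y', forall x,
    inner (T x) y = inner x y'.
  have /(xgetPex (fun=> 0)) : exists S : H' -> H,
    [set S | forall x y, inner (T x) y = inner x (S y)] S by exists T' => ? ?.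
  exact.
move=> {x}{}y; have [M TM] := bounded_operatorP T.
have [| | |y' y'P] := @riesz _ _ (fun x => re_inner y (T x)) _ _
    ((M * rnorm y) ^+ 2) _; last by exists y'; exact: riesz_inner.
- by move=> u v; rewrite linearD re_innerDr.
- by move=> t u; rewrite linearZ re_innerZr.
move=> u; have y0 := rnorm_ge0 y.
have : re_inner y (T u) <= rnorm y * (M * rnorm u).
  apply: le_trans (ler_wpM2l y0 (TM u)).
  exact: le_trans (ler_norm _) (cauchy_schwarz _ _).
by have := sqr_ge0 (M * rnorm y - rnorm u); lra.
Qed.

(** * Measurability and integrability of the frame coefficients *)

(** Each coordinate is 1-Lipschitz for the norm of the direct sum, the
    squared norm being a sum with nonnegative terms. *)
Lemma direct_sum_open_coord (R : realType) (Omega : pointedType)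
    (H_ : Omega -> hilbertType R) (r : R) :
  direct_sum_open [set x : direct_sum H_ | exists w, r < rnorm (x w)].
Proof.
move=> x [w xw]; exists (rnorm (x w) - r); first by rewrite subr_gt0.
move=> y yx; exists w.
have : ((rnorm (x w - y w) ^+ 2)%:E < ((rnorm (x w) - r) ^+ 2)%:E)%E.
  apply: le_lt_trans yx; apply: esum_ge.
  by exists [set w]; [split|rewrite fsbig_set1].
rewrite lte_fin ltr_sqr ?nnegrE ?rnorm_ge0 ?subr_ge0 ?(ltW xw)// => xyw.
have := rnorm_triangle (x w - y w) (y w); rewrite subrK; lra.
Qed.

(** An element of a single summand has at most one nonzero coordinate, so for
    r >= 0 its norm exceeds r exactly if some coordinate does.  This expresses
    { w | r < |F w| } as a preimage of an open set. *)
Lemma measurable_rnorm (R : realType) (d : measure_display)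
    (Omega : measurableType d) (H_ : Omega -> hilbertType R)
    (F : forall w, H_ w) :
  strongly_measurable F -> measurable_fun setT (fun w => rnorm (F w)).
Proof.
move=> mF; apply: (measurability _ (RGenOInfty.measurableE R)).
move=> _ [_ [r ->] <-].
rewrite setTI; have [r0|r0] := ltP r 0.
  rewrite [X in measurable X](_ : _ = setT)//; apply/seteqP; split=> // w _ /=.
  by rewrite in_itv/= andbT (lt_le_trans r0) ?rnorm_ge0.
have mU : measurable ([set x | exists w, r < rnorm (x w)] :
    set (direct_sum_borel H_)).
  by apply: sub_sigma_algebra; exact: direct_sum_open_coord.
have := mF measurableT _ mU.
rewrite setTI; congr measurable; apply/seteqP; split=> w /=.
  case=> v; have [<-|vw] := eqVneq w v; first
    by rewrite dfwithin in_itv/= andbT.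
  by rewrite dfwithout// /rnorm normr0 ltNge r0.
by rewrite in_itv/= andbT => Fw; exists w; rewrite dfwithin.
Qed.

Section frame_operator.
Context (R : realType) (d : measure_display) (Omega : measurableType d).
Context (mu : {measure set Omega -> \bar R}).
Context (H : hilbertType R) (H_ : Omega -> hilbertType R).
Variable Lambda : forall w, 'B(H, H_ w).
Hypothesis bessel : c_g_bessel mu Lambda.

Lemma integrable_sqr_rnorm f :
  mu.-integrable setT (EFin \o (fun w => rnorm (Lambda w f) ^+ 2)).
Proof.
have [mL [B LB]] := bessel; apply/integrableP; split.
  by apply/measurable_EFinP/measurable_funX; exact: measurable_rnorm.
under eq_integral do rewrite /= ger0_norm ?sqr_ge0//.
exact: le_lt_trans (LB f) (ltry _).
Qed.

(** By polarization, this integrand is a combination of the integrands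
    |Lambda_w h|^2 for h = f + g, f, g.  This gives its measurability too, as
    strong measurability is available for every vector of H. *)
Lemma integrable_re_inner f g :
  mu.-integrable setT (EFin \o (fun w => re_inner (Lambda w f) (Lambda w g))).
Proof.
pose q f w := rnorm (Lambda w f) ^+ 2.
apply: (@eq_integrable _ _ _ _ _ measurableT
  (fun w => 2^-1%:E * ((q (f + g) w)%:E - (q f w)%:E - (q g w)%:E))%E).
  by move=> w _; rewrite /= re_inner_polarization -linearD.
apply: integrableZl => //.
apply: integrableB => //; last exact: integrable_sqr_rnorm.
by apply: integrableB => //; exact: integrable_sqr_rnorm.
Qed.

(** * The frame operator *)

(** The value at f represents g |-> \int Re <Lambda_w f, Lambda_w g>.  The
    quadratic bound on this functional comes from the pointwise estimate
    2 Re <x, y> <= b |x|^2 + b^-1 |y|^2, where b > 0 is a Bessel bound: after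
    integration its last term is at most |g|^2. *)
Lemma frame_operatorP f g : inner (frame_operator mu Lambda f) g =
  complex_integral mu (fun w => inner f (adjoint (Lambda w) (Lambda w g))).
Proof.
suff /choice[S SP] : forall f, exists Sf, forall g, inner Sf g =
    complex_integral mu (fun w => inner f (adjoint (Lambda w) (Lambda w g))).
  have /(xgetPex (fun=> 0)) : exists S : H -> H, [set S | forall f g,
    inner (S f) g = complex_integral mu
      (fun w => inner f (adjoint (Lambda w) (Lambda w g)))] S.
    by exists S => ? ?.
  exact.
move=> {g}{}f.
(* a Bessel constant need not be positive, but b is inverted below *)
have [_ [B LB]] := bessel; pose b := Num.max B 1.
have b0 : 0 < b by rewrite /b lt_max ltr01 orbT.
pose Q h := \int[mu]_w rnorm (Lambda w h) ^+ 2.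
have QB h : Q h <= b * rnorm h ^+ 2.
  rewrite -lee_fin /Q fineK;
    last exact: integrable_fin_num (integrable_sqr_rnorm h).
  apply: le_trans (LB h) _.
  by rewrite lee_fin ler_wpM2r ?sqr_ge0// /b le_max lexx.
have [| | |Sf SfP] := @riesz _ _
  (fun g => \int[mu]_w re_inner (Lambda w f) (Lambda w g)) _ _ (b * Q f) _.
- move=> g h.
  rewrite -RintegralD//; try exact: integrable_re_inner.
  by apply: eq_Rintegral => w _; rewrite linearD re_innerDr.
- move=> t g; rewrite -RintegralZl//; last exact: integrable_re_inner.
  by apply: eq_Rintegral => w _; rewrite linearZ re_innerZr.
- move=> g; apply: (@le_trans _ _ (b * Q f + b^-1 * Q g)); last first.
    by rewrite lerD2l ler_pdivrMl.
  rewrite /Q -!RintegralZl//; try exact: integrable_sqr_rnorm;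
    last exact: integrable_re_inner.
  have i1 h c :
      mu.-integrable setT (EFin \o (fun w => c * rnorm (Lambda w h) ^+ 2)).
    exact: (integrableZl measurableT c (integrable_sqr_rnorm h)).
  rewrite -RintegralD//.
  apply: le_Rintegral => //.
  + exact: (integrableZl measurableT 2 (integrable_re_inner f g)).
  + exact: (integrableD measurableT (i1 f b) (i1 g b^-1)).
  move=> w _ /=.
  (* the estimate is b |x - b^-1 y|^2 >= 0, expanded *)
  set x := Lambda w f; set y := Lambda w g.
  have := sqr_ge0 (rnorm (x + (- b^-1)%:C *: y)).
  rewrite sqr_rnormD sqr_rnormZ re_innerZr => /(mulr_ge0 (ltW b0)).
  suff -> : b * (rnorm x ^+ 2 + 2 * (- b^-1 * re_inner x y) +
                 (- b^-1) ^+ 2 * rnorm y ^+ 2) =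
      b * rnorm x ^+ 2 + b^-1 * rnorm y ^+ 2 - 2 * re_inner x y.
    by rewrite subr_ge0.
  by field; exact: lt0r_neq0.
exists Sf => g; rewrite innerE !SfP /complex_integral.
congr (_ +i* _); apply: eq_Rintegral => w _; rewrite -adjointP//.
by rewrite linearZ im_inner.
Qed.

Lemma frame_operator_form f :
  inner (frame_operator mu Lambda f) f =
  (\int[mu]_w rnorm (Lambda w f) ^+ 2)%:C.
Proof.
rewrite frame_operatorP /complex_integral.
under eq_Rintegral do rewrite -adjointP inner_self /=.
under [X in _ +i* X]eq_Rintegral do rewrite -adjointP inner_self /=.
by rewrite Rintegral_cst// mul0r.
Qed.

(** Both sides of the operator inequality at f are real: they are
    A |K^* f|^2 and \int |Lambda_w f|^2, the latter finite by the Bessel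
    bound. *)
Lemma operator_geP (K : 'B(H, H)) (A : R) :
  operator_ge (frame_operator mu Lambda) (fun f => A%:C *: K (adjoint K f)) <->
  forall f, ((A * rnorm (adjoint K f) ^+ 2)%:E <=
             \int[mu]_w (rnorm (Lambda w f) ^+ 2)%:E)%E.
Proof.
suff E f : (inner (A%:C *: K (adjoint K f)) f <=
            inner (frame_operator mu Lambda f) f) =
    ((A * rnorm (adjoint K f) ^+ 2)%:E <=
             \int[mu]_w (rnorm (Lambda w f) ^+ 2)%:E)%E.
  by split=> h f; [rewrite -E; exact: h|rewrite E; exact: h].
rewrite frame_operator_form linearZl_LR/= adjointP inner_self -rmorphM/= lecR.
rewrite -lee_fin fineK//; exact: integrable_fin_num (integrable_sqr_rnorm f).
Qed.

End frame_operator.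

(** * The characterization *)

Theorem lemma2p4 (R : realType) (d : measure_display)
    (Omega : measurableType d) (mu : {measure set Omega -> \bar R})
    (H : hilbertType R) (H_ : Omega -> hilbertType R)
    (K : 'B(H, H)) (Lambda : forall w : Omega, 'B(H, H_ w)) :
  separable H ->
  c_g_bessel mu Lambda ->
  (c_K_g_frame mu K Lambda <->
   exists2 A : R, 0 < A &
     operator_ge (frame_operator mu Lambda)
                 (fun f => A%:C *: K (adjoint K f))).
Proof.
move=> _ bessel; split=> [[_ [A [B [A0 _ AB]]]]|[A A0 SA]].
  by exists A => //; apply/(operator_geP bessel) => f; case: (AB f).
have [mL [B LB]] := bessel; split=> //; exists A, (Num.max A B).
split=> [//||f]; first by rewrite le_max lexx.
split; first exact: (operator_geP bessel K A).1.
apply: le_trans (LB f) _.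
by rewrite lee_fin ler_wpM2r ?sqr_ge0// le_max lexx orbT.
Qed.
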